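(* Let $S=\langle n_1,\ldots,n_p\rangle$ be a numerical semigroup with minimal system of generators $n_1<\cdots<n_p$. Then, for each $j\in\{1,\ldots,p\}$, $\omega(S,n_j)$ is the optimal value of the following problem of optimizing over an efficient set: $$\max\ \sum_{i=1}^p x_i \quad\text{subject to } x \text{ being a non-dominated solution of the multiobjective problem }(\mathrm{SMIP}_j),$$ where $(\mathrm{SMIP}_j)$ is the multiobjective integer linear problem $$\min\ (x_1,\ldots,x_p)\quad\text{s.t.}\quad \sum_{i=1}^p x_i n_i-\sum_{i=1}^p y_i n_i=n_j,\quad x,y\in\mathbb{Z}_+^p .$$
   Context: $\mathbb{N}=\mathbb{Z}_+$ denotes the set of non-negative integers. A numerical semigroup is a subset $S\subseteq\mathbb{N}$ closed under addition, containing $0$, and such that $\mathbb{N}\setminus S$ is finite. We write $S=\langle n_1,\ldots,n_p\rangle$ when $S=\{\sum_{i=1}^p n_i x_i : x_i\in\mathbb{N}\}$; throughout, $\{n_1,\ldots,n_p\}$ is the (unique) minimal system of generators of $S$ (no proper subset generates $S$) and $n_1<\cdots<n_p$. For $s\in S$, $\omega(S,s)$ denotes the smallest $N\in\mathbb{N}\cup\{\infty\}$ with the following property: for all $n\in\mathbb{N}$ and $s_1,\ldots,s_n\in S$, if $\sum_{i=1}^n s_i-s\in S$, then there exists a subset $\Omega\subseteq\{1,\ldots,n\}$ with $|\Omega|\le N$ and $\sum_{i\in\Omega}s_i-s\in S$. Non-dominated solution of the (minimization) problem $(\mathrm{SMIP}_j)$: a vector $x\in\mathbb{Z}_+^p$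 that is feasible (i.e. there is $y\in\mathbb{Z}_+^p$ with $(x,y)$ satisfying the constraints) and such that there is no feasible vector $x'\ne x$ with $x'\le x$ component-wise. *)

(* Defs.v *)
From HB Require Import structures.
From mathcomp Require Import all_boot all_order all_algebra.
From mathcomp Require Import boolp classical_sets cardinality.

Set Implicit Arguments.
Unset Strict Implicit.
Unset Printing Implicit Defensive.

Import Order.TTheory GRing.Theory Num.Theory.

Local Open Scope classical_set_scope.
Local Open Scope nat_scope.

Definition numerical_semigroup (S : set nat) : Prop :=
  [/\ S 0, (forall a b, S a -> S b -> S (a + b)) & finite_set (~` S)].

Definition generated_by p (n : 'I_p -> nat) (A : {set 'I_p}) : set nat :=
  [set a | exists x : {ffun 'I_p -> nat}, a = \sum_(i in A) n i * x i].

(* Proper subsets of {n_1, ..., n_p} are given by proper sets of indices, which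
   is the intended meaning when n is injective. *)
Definition minimal_generators p (S : set nat) (n : 'I_p -> nat) : Prop :=
  generated_by n [set: 'I_p] = S /\
  (forall A : {set 'I_p}, A \proper [set: 'I_p] -> generated_by n A <> S).

(* a - b \in S, the difference being taken in the integers: truncated
   subtraction would be wrong here since 0 \in S. *)
Definition diff_in (S : set nat) (a b : nat) : Prop :=
  exists2 t : nat, S t & (a%:Z - b%:Z = t%:Z)%R.

Definition omega_bound (S : set nat) (s N : nat) : Prop :=
  forall (k : nat) (u : 'I_k -> nat),
    (forall i, S (u i)) ->
    diff_in S (\sum_(i < k) u i) s ->
    exists2 Omega : {set 'I_k},
      #|Omega| <= N & diff_in S (\sum_(i in Omega) u i) s.

(* None stands for infinity, which always has the property defining omega. *)
Definition omega (S : set nat) (s : nat) : option nat :=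
  match pselect (exists N, `[< omega_bound S s N >]) with
  | left h => Some (ex_minn h)
  | right _ => None
  end.

Definition SMIP_feasible p (n : 'I_p -> nat) (j : 'I_p) :
    set {ffun 'I_p -> nat} :=
  [set x | exists y : {ffun 'I_p -> nat},
    ((\sum_(i < p) x i * n i)%N%:Z - (\sum_(i < p) y i * n i)%N%:Z
       = (n j)%:Z)%R].

Definition non_dominated p (F : set {ffun 'I_p -> nat}) :
    set {ffun 'I_p -> nat} :=
  [set x | F x /\
    ~ (exists x' : {ffun 'I_p -> nat},
         [/\ F x', x' <> x & forall i, x' i <= x i])].

Definition is_max_value (X : Type) (f : X -> nat) (F : set X) (v : nat) : Prop :=
  (exists2 x, F x & f x = v) /\ (forall x, F x -> f x <= v).

(* Main.v *)
Require Import Defs.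
From mathcomp Require Import all_boot all_order all_algebra.
From mathcomp Require Import boolp classical_sets cardinality.
From mathcomp Require Import zify.

Set Implicit Arguments.
Unset Strict Implicit.
Unset Printing Implicit Defensive.

Local Open Scope nat_scope.

(** Write [s <= a] in the divisibility order of [S] when [a - s] lies in [S];
    as [S] is closed under addition, this is stable under adding elements of
    [S] to [a].  A vector [x] is feasible exactly when [s] is below its weight
    [\sum_i x i * n i], so feasibility is stable under increasing [x], and a
    feasible vector is non-dominated exactly when it stops being feasible
    after lowering any one of its positive entries by one.

    The values [\sum_i x i] of non-dominated [x] have a maximum [v]: a cofinite
    [S] contains every large number, so a vector of large weight stays feasible
    when an entry is lowered, and the weight bounds [\sum_i x i] because minimal
    generators are positive ([non_dominated_size_bounded]).

    The number [v] has the property defining [omega]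
    ([omega_bound_of_non_dominated]).  If [s] is below [\sum_i u i], factor each
    [u i] over the generators and discard atoms from these factorizations, one
    at a time, as long as what remains is feasible.  The atoms that remain form
    a non-dominated vector, so there are at most [v] of them, and the [u i] that
    keep at least one atom form the required subset.

    No smaller number works ([non_dominated_size_le_omega_bound]): a
    non-dominated [x], read as a list of [\sum_i x i] generators, has no proper
    sublist whose sum is above [s]. *)

Definition weight p (n : 'I_p -> nat) (x : {ffun 'I_p -> nat}) : nat :=
  \sum_(i < p) x i * n i.

Definition covers p (S : set nat) (n : 'I_p -> nat) (s : nat) :
    set {ffun 'I_p -> nat} :=
  fun x => diff_in S (weight n x) s.

Definition lower p (x : {ffun 'I_p -> nat}) (a : 'I_p) : {ffun 'I_p -> nat} :=
  [ffun b => x b - (b == a)].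

Definition total p (I : finType) (Z : I -> {ffun 'I_p -> nat}) :
    {ffun 'I_p -> nat} :=
  [ffun a => \sum_i Z i a].

Definition up_closed p (F : set {ffun 'I_p -> nat}) : Prop :=
  forall x y : {ffun 'I_p -> nat}, F x -> (forall i, x i <= y i) -> F y.

Lemma diff_inP (S : set nat) (a s : nat) :
  diff_in S a s <-> exists2 t, S t & a = s + t.
Proof. by split=> -[t St e]; exists t => //; lia. Qed.

(** * Vectors of multiplicities *)

Lemma weight_lower p (n : 'I_p -> nat) (x : {ffun 'I_p -> nat}) (a : 'I_p) :
  0 < x a -> weight n x = weight n (lower x a) + n a.
Proof.
move=> xa; rewrite /weight (bigD1 a) //= [in RHS](bigD1 a) //= ffunE eqxx.
rewrite (eq_bigr (fun i => lower x a i * n i)); last first.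
  by move=> i /negbTE ia; rewrite ffunE ia subn0.
by case: (x a) xa => // m _; rewrite subn1 /= mulSn; lia.
Qed.

Lemma sum_lower p (x : {ffun 'I_p -> nat}) (a : 'I_p) :
  0 < x a -> \sum_i x i = \sum_i lower x a i + 1.
Proof.
move=> xa; have := weight_lower (fun=> 1) xa.
by rewrite /weight -!big_distrl /= !muln1.
Qed.

Lemma weight_total p (n : 'I_p -> nat) (I : finType)
    (Z : I -> {ffun 'I_p -> nat}) :
  weight n (total Z) = \sum_i weight n (Z i).
Proof.
rewrite /weight exchange_big; apply: eq_bigr => a _.
by rewrite ffunE big_distrl.
Qed.

(** Only one-step descents have to be examined, since [F] is up-closed: this is
    what makes greedy discarding end at a non-dominated vector. *)
Lemma non_dominated_lower p (F : set {ffun 'I_p -> nat})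
    (x : {ffun 'I_p -> nat}) :
  up_closed F -> F x -> (forall a, 0 < x a -> ~ F (lower x a)) ->
  non_dominated F x.
Proof.
move=> Fup Fx min; split=> // -[y [Fy yx le]]; apply: yx; apply/ffunP => a.
apply/eqP; rewrite eqn_leq le leqNgt; apply/negP => lt.
apply: (min a); first exact: leq_ltn_trans lt.
apply: Fup Fy _ => b; rewrite ffunE; case: eqP => [->|_]; last by rewrite subn0.
by rewrite subn1; case: (x a) lt.
Qed.

Lemma non_dominated_lowerN p (F : set {ffun 'I_p -> nat})
    (x : {ffun 'I_p -> nat}) (a : 'I_p) :
  non_dominated F x -> 0 < x a -> ~ F (lower x a).
Proof.
move=> [_ nd] xa Flo; apply: nd; exists (lower x a); split=> //.
  by move/ffunP/(_ a); rewrite ffunE eqxx; case: (x a) xa => // m _; lia.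
by move=> i; rewrite ffunE leq_subr.
Qed.

(** Discarding is done in the family [X] rather than in its total, so that each
    surviving atom is still attached to the index it came from. *)
Lemma non_dominated_subfamily p (F : set {ffun 'I_p -> nat}) (I : finType)
    (X : I -> {ffun 'I_p -> nat}) :
  up_closed F -> F (total X) ->
  exists2 Z : I -> {ffun 'I_p -> nat},
    (forall i a, Z i a <= X i a) & non_dominated F (total Z).
Proof.
move=> Fup; have [m] := ubnP (\sum_i \sum_a X i a).
elim: m X => // m IHm X /ltnSE ltm FX.
have [[i [a [Xia FY]]]|nex] := pselect (exists i a, 0 < X i a /\
    F (total (fun k => if k == i then lower (X i) a else X k))).
  case: (IHm _ _ FY) => [|Z ZY ndZ].
    apply: leq_trans ltm.
    rewrite (bigD1 i) //= eqxx [ltnRHS](bigD1 i) //= (sum_lower Xia) addn1 addSn.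
    rewrite ltnS leq_add2l leq_sum // => k /negbTE ki.
    by rewrite ki.
  exists Z => // k b; apply: leq_trans (ZY k b) _.
  by case: eqP => // ->; rewrite ffunE leq_subr.
exists X => //; apply: non_dominated_lower => // a.
rewrite ffunE lt0n sum_nat_eq0 negb_forall => /existsP[i].
rewrite /= -lt0n => Xia Flo; apply: nex; exists i, a; split=> //.
apply: Fup Flo _ => b; rewrite !ffunE (bigD1 i) //= [leqRHS](bigD1 i) //= eqxx.
rewrite [in leqRHS](eq_bigr (fun k => X k b)); last by move=> k /negbTE ->.
rewrite ffunE; case: eqP => [->|_]; last by rewrite !subn0.
by rewrite !subn1; case: (X i a) Xia.
Qed.

(** * Covering vectors of a semigroup *)

Section Covers.

Variables (p : nat) (S : set nat) (n : 'I_p -> nat).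
Hypothesis S_semigroup : numerical_semigroup S.
Hypothesis n_gen : generated_by n [set: 'I_p] = S.

Lemma semigroup_weightP a :
  S a <-> exists x : {ffun 'I_p -> nat}, a = weight n x.
Proof.
rewrite -n_gen; split=> -[x ->]; exists x; rewrite /weight;
  by apply: eq_big => [i|i _]; rewrite ?inE // mulnC.
Qed.

Lemma diff_in_add a b s : diff_in S a s -> S b -> diff_in S (a + b) s.
Proof.
have [_ addS _] := S_semigroup.
move=> /diff_inP[t St ->] Sb; apply/diff_inP; exists (t + b); first exact: addS.
by rewrite addnA.
Qed.

Lemma covers_up_closed s : up_closed (covers S n s).
Proof.
move=> x y cx le; rewrite /covers.
have -> : weight n y = weight n x + weight n [ffun i => y i - x i].
  rewrite /weight -big_split; apply: eq_bigr => i _.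
  by rewrite ffunE /= -mulnDl subnKC.
by apply: diff_in_add => //; apply/semigroup_weightP; eexists.
Qed.

Lemma SMIP_feasible_covers j : SMIP_feasible n j = covers S n (n j).
Proof.
apply/funext => x; apply/propext; split.
  case=> y e; exists (weight n y); first by apply/semigroup_weightP; exists y.
  by rewrite /weight; lia.
by case=> _ /semigroup_weightP[y ->] e; exists y; rewrite /weight in e; lia.
Qed.

Lemma cofinite_conductor : exists c, forall m, c <= m -> S m.
Proof.
have [_ _ /finite_seqP[r rE]] := S_semigroup.
exists (\max_(i <- r) i).+1 => m lem; apply: contrapT => nSm.
have : [set` r]%classic m by rewrite -rE.
by move=> /= mr; have := @leq_bigmax_seq _ r xpredT id m mr isT; lia.
Qed.

(** Lowering an entry costs at most [\sum_i n i] of weight, and any weight at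
    least [s] plus the conductor is still above [s]. *)
Lemma non_dominated_size_bounded s :
  (forall i, 0 < n i) ->
  exists C, forall x, non_dominated (covers S n s) x -> \sum_i x i <= C.
Proof.
move=> n_gt0; have [c cP] := cofinite_conductor.
exists (s + c + \sum_i n i) => x ndx; rewrite leqNgt; apply/negP => big.
have [a xa] : exists a, 0 < x a.
  have : 0 < \sum_i x i by apply: leq_ltn_trans big.
  by rewrite lt0n sum_nat_eq0 negb_forall => /existsP[a]; exists a; rewrite lt0n.
have size_le : \sum_i x i <= weight n x.
  by apply: leq_sum => i _; rewrite leq_pmulr.
have na_le : n a <= \sum_i n i by rewrite (bigD1 a) //= leq_addr.
apply: (non_dominated_lowerN ndx xa); apply/diff_inP.
have wE := weight_lower n xa.
by exists (weight n (lower x a) - s); [apply: cP|]; lia.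
Qed.

Lemma non_dominated_covers_exists s :
  S s -> exists x, non_dominated (covers S n s) x.
Proof.
have [S0 _ _] := S_semigroup.
move=> /semigroup_weightP[x xE].
have [|Z _ ndZ] := @non_dominated_subfamily p (covers S n s) unit (fun=> x)
    (@covers_up_closed s); last by exists (total Z).
apply/diff_inP; exists 0 => //.
by rewrite weight_total big_const card_unit /= addn0 -xE addn0.
Qed.

Lemma omega_bound_of_non_dominated s v :
  (forall x, non_dominated (covers S n s) x -> \sum_i x i <= v) ->
  omega_bound S s v.
Proof.
move=> vP k u Su du.
have /choice[X XE] : forall i, exists x, u i = weight n x.
  by move=> i; apply/semigroup_weightP.
have [|Z ZX ndZ] := @non_dominated_subfamily p (covers S n s) _ X
    (@covers_up_closed s).
  by rewrite /covers weight_total (eq_bigr u) // => i _; rewrite XE.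
have ZE i : \sum_a Z i a = 0 -> weight n (Z i) = 0.
  move=> /eqP; rewrite sum_nat_eq0 => /forallP Z0.
  by rewrite /weight big1 // => a _; rewrite (eqP (Z0 a)).
exists [set i | 0 < \sum_a Z i a]%SET.
  apply: leq_trans (vP _ ndZ).
  have -> : \sum_a total Z a = \sum_i \sum_a Z i a.
    by rewrite exchange_big; apply: eq_bigr => a _; rewrite ffunE.
  rewrite -sum1_card big_mkcond; apply: leq_sum => i _.
  by rewrite inE; case: ifP.
(* The chosen [u i] weigh at least as much as the atoms kept, and the excess is
   the weight of the discarded atoms, hence in [S]. *)
have [cZ _] := ndZ.
pose Y := total (fun i => if 0 < \sum_a Z i a then X i else [ffun=> 0]).
have -> : \sum_(i in [set i | 0 < \sum_a Z i a]%SET) u i = weight n Y.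
  rewrite weight_total big_mkcond; apply: eq_bigr => i _.
  rewrite inE; case: ifP => // _.
  by rewrite /weight big1 // => a _; rewrite ffunE.
apply: (covers_up_closed cZ) => a; rewrite !ffunE; apply: leq_sum => i _.
case: ifP => // /negbT; rewrite -eqn0Ngt sum_nat_eq0 => /forallP Z0.
by rewrite (eqP (Z0 a)).
Qed.

End Covers.

(** * Lower bound for omega *)

Lemma omega_bound_finType (S : set nat) (s N : nat) (I : finType)
    (u : I -> nat) :
  omega_bound S s N -> (forall i, S (u i)) -> diff_in S (\sum_i u i) s ->
  exists2 Omega : {set I},
    #|Omega| <= N & diff_in S (\sum_(i in Omega) u i) s.
Proof.
move=> bound Su du.
have [|Omega cardO dO] := bound #|I| (fun i => u (enum_val i)) (fun i => Su _).
  by rewrite (reindex _ (onW_bij _ (enum_val_bij I))) in du.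
exists [set enum_val i | i in Omega]%SET.
  by rewrite card_imset //; apply: enum_val_inj.
by rewrite big_imset //= => i k _ _; apply: enum_val_inj.
Qed.

Lemma sum_tag p (x : {ffun 'I_p -> nat}) (f : 'I_p -> nat)
    (Omega : {set {a : 'I_p & 'I_(x a)}}) :
  \sum_(i in Omega) f (tag i) =
  \sum_a
    #|[set r : 'I_(x a) | Tagged (fun b => 'I_(x b)) r \in Omega]%SET| * f a.
Proof.
transitivity (\sum_a \sum_(r : 'I_(x a) |
    Tagged (fun b => 'I_(x b)) r \in Omega) f a).
  by rewrite sig_big_dep /=; apply: eq_bigl => -[].
apply: eq_bigr => a _; rewrite sum_nat_const; congr (_ * _).
by apply: eq_card => r; rewrite inE.
Qed.

(** The list of generators with multiplicities [x] is indexed by pairs of a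
    generator and a rank below its multiplicity; a set of such pairs gives a
    vector below [x], by counting how many pairs sit over each generator. *)
Lemma non_dominated_size_le_omega_bound p (S : set nat) (n : 'I_p -> nat)
    (s N : nat) (x : {ffun 'I_p -> nat}) :
  (forall i, S (n i)) -> omega_bound S s N ->
  non_dominated (covers S n s) x -> \sum_i x i <= N.
Proof.
move=> Sn bound [cx ndx].
pose I := {a : 'I_p & 'I_(x a)}.
have [//||Omega cardO dO] :=
    @omega_bound_finType S s N I (fun i => n (tag i)) bound.
  have -> : \sum_(i : I) n (tag i) = weight n x.
    transitivity (\sum_(i in [set: I]) n (tag i)).
      by apply: eq_bigl => i; rewrite inE.
    rewrite sum_tag.
    apply: eq_bigr => a _; congr (_ * _).
    by rewrite -[RHS]card_ord; apply: eq_card => r; rewrite !inE.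
  exact: cx.
pose y : {ffun 'I_p -> nat} := [ffun a =>
  #|[set r : 'I_(x a) | Tagged (fun b => 'I_(x b)) r \in Omega]%SET|].
have yx a : y a <= x a by rewrite ffunE -[leqRHS]card_ord max_card.
have wy : \sum_(i in Omega) n (tag i) = weight n y.
  by rewrite sum_tag; apply: eq_bigr => a _; rewrite ffunE.
have sy : #|Omega| = \sum_a y a.
  rewrite -sum1_card (sum_tag (fun=> 1)).
  by apply: eq_bigr => a _; rewrite muln1 ffunE.
have <- : y = x.
  apply: contrapT => neq; apply: ndx; exists y; split=> //.
  by rewrite /covers -wy.
by rewrite -sy.
Qed.

(** * Omega as the maximum *)

(** A zero generator could be dropped without changing the semigroup. *)
Lemma minimal_generators_gt0 p (S : set nat) (n : 'I_p -> nat) :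
  minimal_generators S n -> forall i, 0 < n i.
Proof.
move=> [gen min] i; rewrite lt0n; apply/eqP => ni0.
apply: (min [set~ i]%SET).
  apply/properP; split; first by apply/fintype.subsetP => k _; rewrite in_setE.
  by exists i; rewrite ?in_setE // !inE eqxx.
have drop x : \sum_(k in [set: 'I_p]) n k * x k
    = \sum_(k in [set~ i]%SET) n k * x k.
  rewrite (bigD1 i) ?inE //= ni0 add0n.
  by apply: eq_bigl => k; rewrite !inE.
by rewrite -gen; apply/funext => a; apply/propext; split=> -[x ->]; exists x.
Qed.

Lemma omega_eq (S : set nat) (s v : nat) :
  omega_bound S s v -> (forall N, omega_bound S s N -> v <= N) ->
  omega S s = Some v.
Proof.
move=> bv minv; rewrite /omega; case: pselect => [h|[]]; last first.
  by exists v; apply/asboolP.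
case: ex_minnP => m /asboolP bm minm; congr Some; apply/eqP.
by rewrite eqn_leq minv // minm //; apply/asboolP.
Qed.

Lemma max_value_exists (X : Type) (f : X -> nat) (F : set X) :
  (exists x, F x) -> (exists C, forall x, F x -> f x <= C) ->
  exists v, is_max_value f F v.
Proof.
move=> [x0 Fx0] [C CP].
have ex : exists v, `[< exists2 x, F x & f x = v >].
  by exists (f x0); apply/asboolP; exists x0.
have ub v : `[< exists2 x, F x & f x = v >] -> v <= C.
  by move=> /asboolP[x Fx <-]; apply: CP.
case: (ex_maxnP ex ub) => v /asboolP vE vmax; exists v; split=> // x Fx.
by apply: vmax; apply/asboolP; exists x.
Qed.

Theorem theorem2p3 (p : nat) (n : 'I_p -> nat) (S : set nat)
    (S_semigroup : numerical_semigroup S)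
    (n_gen : minimal_generators S n)
    (n_incr : forall i k : 'I_p, i < k -> n i < n k)
    (j : 'I_p) :
  exists2 v : nat,
    omega S (n j) = Some v &
    is_max_value (fun x : {ffun 'I_p -> nat} => \sum_(i < p) x i)
                 (non_dominated (SMIP_feasible n j)) v.
Proof.
have n_gt0 := minimal_generators_gt0 n_gen; have [gen _] := n_gen.
have Sn i : S (n i).
  apply/(semigroup_weightP gen); exists [ffun a => (a == i) : nat].
  rewrite /weight (bigD1 i) //= ffunE eqxx mul1n big1 ?addn0 // => a /negbTE ai.
  by rewrite ffunE ai.
rewrite (SMIP_feasible_covers gen).
have [v vmax] := @max_value_exists _ (fun x : {ffun 'I_p -> nat} => \sum_i x i)
  _ (non_dominated_covers_exists S_semigroup gen (Sn j))
  (non_dominated_size_bounded S_semigroup (n j) n_gt0).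
exists v => //; have [[x ndx xv] vub] := vmax; apply: omega_eq.
  exact: (omega_bound_of_non_dominated S_semigroup gen vub).
by move=> N bN; rewrite -xv; apply: non_dominated_size_le_omega_bound ndx.
Qed.
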